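(* For $r\ge 1$, let $\mathfrak{g}_r=\mathfrak{p}^A\frac{2|\cdots|2|1}{2r+1}$, where the top composition consists of $r$ parts equal to $2$ followed by one part equal to $1$. Then there exist positive integers $a_r>b_r$ such that the spectrum of $\mathfrak{g}_r$ is $\{-1^{b_r},0^{a_r},1^{a_r},2^{b_r}\}$.
   Context: Type-A seaweeds: for compositions $\underline a=(a_1,\dots,a_m)$ and $\underline b=(b_1,\dots,b_t)$ of $n$, let $e_1,\dots,e_n$ be a basis of $V=\mathbb{C}^n$, $V_i=\mathrm{span}\{e_1,\dots,e_{a_1+\dots+a_i}\}$ and $W_j=\mathrm{span}\{e_{b_1+\dots+b_j+1},\dots,e_n\}$. The type-A seaweed $\mathfrak{p}^A\frac{a_1|\cdots|a_m}{b_1|\cdots|b_t}$ is the subalgebra of $\mathfrak{sl}(n)$ of matrices preserving both flags $0\subset V_1\subset\dots\subset V_m=V$ and $V=W_0\supset W_1\supset\dots\supset W_t=0$. These algebras $\mathfrak{g}_r$ are Frobenius: there is $F\in\mathfrak{g}^*$ with $(x,y)\mapsto F([x,y])$ nondegenerate; then there is a unique $\widehat F\in\mathfrak{g}$ with $F([\widehat F,x])=F(x)$ for all $x$, and the spectrum of $\mathfrak{g}$ is the multiset of eigenvalues of $\mathrm{ad}\,\widehat F$ on $\mathfrak{g}$ (independent of the choice of Frobenius $F$). Notation: $\{x^k\}$ denotes $x$ with multiplicity $k$. *)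

(* Defs.v *)
From HB Require Import structures.
From mathcomp Require Export all_boot all_order all_algebra.
From mathcomp Require Export reals complex.

Set Implicit Arguments.
Unset Strict Implicit.
Unset Printing Implicit Defensive.

Import GRing.Theory.
Local Open Scope ring_scope.

Section LieSubalgebra.

Variables (K : fieldType) (n : nat).
Implicit Types (g : {vspace 'M[K]_n}).

Definition lie_mx (x y : 'M[K]_n) : 'M[K]_n := x *m y - y *m x.

(* [subvs_of g] is the vector space g as a type of its own, so 'Hom(subvs_of
   g, K^o) is the dual g^* and 'End(subvs_of g) is gl(g). The projection
   [vsproj g] only retypes the commutator as an element of g: it is the
   identity there as soon as g is closed under commutators, see
   [vsval_lie_seaweed]. *)
Definition lie g (x y : subvs_of g) : subvs_of g :=
  vsproj g (lie_mx (vsval x) (vsval y)).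

Lemma lie_is_linear g (x : subvs_of g) : linear (lie x).
Proof.
move=> k y z; rewrite /lie -linearP; congr (vsproj g _).
have -> : vsval (k *: y + z) = k *: vsval y + vsval z by exact: linearP.
rewrite /lie_mx mulmxDr mulmxDl -scalemxAr -scalemxAl.
by rewrite scalerBr opprD addrACA.
Qed.

HB.instance Definition _ g (x : subvs_of g) :=
  GRing.isLinear.Build K (subvs_of g) (subvs_of g) _ (lie x)
    (lie_is_linear x).

Definition ad g (x : subvs_of g) : 'End(subvs_of g) := linfun (lie x).

(* The form (x, y) |-> F [x, y] is alternating, so triviality of its left
   kernel is nondegeneracy. *)
Definition frobenius_functional g (F : 'Hom(subvs_of g, K^o)) : Prop :=
  forall x, (forall y, F (lie x y) = 0) -> x = 0.

Definition frobenius g : Prop :=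
  exists F : 'Hom(subvs_of g, K^o), frobenius_functional F.

Definition principal_element g (F : 'Hom(subvs_of g, K^o))
    (h : subvs_of g) : Prop :=
  forall x, F (lie h x) = F x.

End LieSubalgebra.

Section Spectrum.

Variables (C : closedFieldType).

(* The eigenvalues with their algebraic multiplicities, as a list whose order
   is irrelevant; the characteristic polynomial does not depend on the basis. *)
Definition char_poly_end (V : vectType C) (f : 'End(V)) : {poly C} :=
  char_poly (passmx.mxof (vbasis {:V}) (vbasis {:V}) f).

Definition eigenvalues (V : vectType C) (f : 'End(V)) : seq C :=
  sval (closed_field_poly_normal (char_poly_end f)).

Lemma eigenvaluesE (V : vectType C) (f : 'End(V)) :
  char_poly_end f = \prod_(z <- eigenvalues f) ('X - z%:P).
Proof.
rewrite /eigenvalues; case: closed_field_poly_normal => s /= {1}->.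
by rewrite (monicP (char_poly_monic _)) scale1r.
Qed.

(* g is Frobenius and, whichever Frobenius functional F is chosen, the
   multiset of eigenvalues of ad h is s, where h is the unique principal
   element of F. *)
Definition has_spectrum n (g : {vspace 'M[C]_n}) (s : seq C) : Prop :=
  frobenius g /\
  forall F : 'Hom(subvs_of g, C^o), frobenius_functional F ->
    exists h : subvs_of g,
      unique (principal_element F) h /\ perm_eq (eigenvalues (ad h)) s.

End Spectrum.

Section Seaweed.

Variables (K : fieldType) (n : nat).
Implicit Types (U : {vspace 'cV[K]_n}) (a b : seq nat).

Definition trace0 : {vspace 'M[K]_n} :=
  lker (linfun (mxtrace : 'M[K]_n -> K^o)).

Definition stabilizer U : {vspace 'M[K]_n} :=
  (\bigcap_(v <- vbasis U)
     linfun (mulmxr v : 'M[K]_n -> 'cV[K]_n) @^-1: U)%VS.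

(* The standard basis e_1, ..., e_n is numbered from 0 here. *)
Definition lower_span k : {vspace 'cV[K]_n} :=
  <<[seq (delta_mx i 0 : 'cV[K]_n)%R | i : 'I_n <- enum 'I_n & (i < k)%N]>>%VS.

Definition upper_span k : {vspace 'cV[K]_n} :=
  <<[seq (delta_mx i 0 : 'cV[K]_n)%R | i : 'I_n <- enum 'I_n & (k <= i)%N]>>%VS.

Definition flagV a i := lower_span (sumn (take i a)).
Definition flagW b j := upper_span (sumn (take j b)).

(* The type-A seaweed in sl(n), for a and b compositions of n. *)
Definition seaweed a b : {vspace 'M[K]_n} :=
  (trace0 :&: (\bigcap_(i < (size a).+1) stabilizer (flagV a i))
          :&: (\bigcap_(j < (size b).+1) stabilizer (flagW b j)))%VS.

Lemma memv_bigcap (vT : vectType K) (I : Type) (s : seq I)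
    (Us : I -> {vspace vT}) (v : vT) :
  (v \in (\bigcap_(i <- s) Us i)%VS) = all (fun i => v \in Us i) s.
Proof.
elim: s => [|i s IHs]; first by rewrite big_nil memvf.
by rewrite big_cons memv_cap IHs.
Qed.

Lemma mem_trace0 (x : 'M[K]_n) : (x \in trace0) = (\tr x == 0).
Proof. by rewrite memv_ker lfunE. Qed.

Lemma mem_stabilizer U (x : 'M[K]_n) :
  reflect (forall v, v \in U -> x *m v \in U) (x \in stabilizer U).
Proof.
have memE v : (x \in (linfun (mulmxr v : 'M[K]_n -> 'cV[K]_n) @^-1: U)%VS)
              = (x *m v \in U) by rewrite -memv_preim lfunE.
rewrite memv_bigcap; apply: (iffP allP) => [xU v Uv | xU v /vbasis_mem Uv].
  rewrite (coord_vbasis Uv) mulmx_sumr memv_suml // => i _.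
  by rewrite -scalemxAr memvZ // -memE xU // mem_nth // size_tuple.
by rewrite memE xU.
Qed.

Lemma mem_seaweed a b (x : 'M[K]_n) :
  x \in seaweed a b <->
  [/\ \tr x = 0,
      forall i, (i <= size a)%N ->
        forall v, v \in flagV a i -> x *m v \in flagV a i
    & forall j, (j <= size b)%N ->
        forall v, v \in flagW b j -> x *m v \in flagW b j].
Proof.
rewrite !memv_cap mem_trace0 !memv_bigcap; split.
  case/andP=> /andP[/eqP trx /allP xV] /allP xW; split=> // [i | j];
    rewrite -ltnS => lt_i.
    by apply/mem_stabilizer/(xV (Ordinal lt_i)); rewrite mem_index_enum.
  by apply/mem_stabilizer/(xW (Ordinal lt_i)); rewrite mem_index_enum.
case=> -> xV xW; rewrite eqxx /=; apply/andP.
by split; apply/allP=> i _; apply/mem_stabilizer;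
  [apply: xV | apply: xW]; rewrite -ltnS.
Qed.

Lemma lie_mx_seaweed a b (x y : 'M[K]_n) :
  x \in seaweed a b -> y \in seaweed a b -> lie_mx x y \in seaweed a b.
Proof.
move=> /mem_seaweed[_ xV xW] /mem_seaweed[_ yV yW].
apply/mem_seaweed; split=> [|i le_i v Uv|j le_j v Uv].
- by rewrite linearB /= mxtrace_mulC subrr.
- by rewrite mulmxBl -!mulmxA memvB ?(xV, yV).
- by rewrite mulmxBl -!mulmxA memvB ?(xW, yW).
Qed.

Lemma vsval_lie_seaweed a b (x y : subvs_of (seaweed a b)) :
  vsval (lie x y) = lie_mx (vsval x) (vsval y).
Proof. by rewrite vsprojK // lie_mx_seaweed ?subvsP. Qed.

End Seaweed.

(* Main.v *)
From HB Require Import structures.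
Require Import Defs.
From mathcomp Require Import perm zify ring.

Set Implicit Arguments.
Unset Strict Implicit.
Unset Printing Implicit Defensive.

Import GRing.Theory Num.Theory passmx.
Local Open Scope ring_scope.
Local Open Scope complex_scope.

(** The spectrum does not depend on the Frobenius functional: along the line
    f + t d joining two of them, the principal element h satisfies the Lax
    equation h' = -[y, h], where y represents d through the form of f + t d, so
    ad h undergoes an infinitesimal conjugation and its characteristic
    polynomial, a rational function of t, has derivative zero.

    It is then enough to treat the functional F carried by the meander graph of
    g_r, a path on the 2r+1 vertices. Its principal element is diagonal up to a
    scalar matrix, with entries in {0, 1, 2}, and the matrix units are
    eigenvectors with weights in {-1, 0, 1, 2}. The form F([x, y]) pairs the
    weights w and 1 - w, so -1 and 2 have the same multiplicity b, and 0 and 1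
    the same multiplicity a. Finally E_ij |-> E_(i-1)j injects the weight 2 into
    the weight 1, and misses E_10 (with rows and columns numbered from 0). *)

(** * Nondegeneracy of the meander form, in coordinates *)

(* [XE] is the equation A X = X A at the entries (u, v) with v./2 <= u./2, for
   the matrix A of the meander functional, see [meander_mx]. *)
Lemma meander_kernel (K : fieldType) (r : nat) (X : nat -> nat -> K) :
  let N := r.*2 in
  (0 < r)%N ->
  (forall i j, (j./2 < i./2)%N -> X i j = 0) ->
  (forall u v, (u <= N)%N -> (v <= N)%N -> (v./2 <= u./2)%N ->
     (if ~~ odd u && (u < N)%N then X u.+1 v else 0)
     + (if (r < u)%N then X (N - u)%N v else 0)
     = (if odd v then X u v.-1 else 0)
       + (if (v < r)%N then X u (N - v)%N else 0)) ->
  (N.+1)%:R != 0 :> K ->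
  \sum_(i < N.+1) X i i = 0 ->
  forall i j, (i <= N)%N -> (j <= N)%N -> X i j = 0.
Proof.
move=> N r_gt0 X0 XE N0 trX.
(* For [X1], [X2] and [X3] the equation is taken at a reflected position, where block triangularity
   kills both top-arc terms. One bottom-arc term is left for [X1] and [X2], two for [X3]. *)
have X1 i j : (i <= r)%N -> (j <= N)%N -> ((N - j)./2 < i./2)%N -> X i j = 0.
  move=> ir jN ji; have := XE i (N - j)%N; rewrite /N in ji jN *.
  move=> /(_ ltac:(lia) ltac:(lia) ltac:(lia)).
  have -> : (r.*2 - j < r)%N = true by lia.
  have -> : (r < i)%N = false by lia.
  have -> : (r.*2 - (r.*2 - j) = j)%N by lia.
  rewrite addr0; case: ifP => _; rewrite ?(X0 i.+1); try lia.
    by case: ifP => ?; rewrite ?(X0 _ (r.*2 - j).-1) ?add0r //; lia.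
  by case: ifP => ?; rewrite ?(X0 _ (r.*2 - j).-1) ?add0r //; lia.
have X2 i j : (i <= N)%N -> (r <= j <= N)%N -> (j./2 < (N - i)./2)%N -> X i j = 0.
  move=> iN rj ji; have := XE (N - i)%N j; rewrite /N in ji rj iN *.
  move=> /(_ ltac:(lia) ltac:(lia) ltac:(lia)).
  have -> : (j < r)%N = false by lia.
  have -> : (r < r.*2 - i)%N = true by lia.
  have -> : (r.*2 - (r.*2 - i) = i)%N by lia.
  rewrite addr0; case: ifP => _; rewrite ?(X0 (r.*2 - i).+1); try lia.
    by case: ifP => ?; rewrite ?(X0 _ j.-1) ?add0r //; lia.
  by case: ifP => ?; rewrite ?(X0 _ j.-1) ?add0r //; lia.
have X3 i j : (i < r)%N -> (j < r)%N -> X i j = X (N - i)%N (N - j)%N.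
  move=> ir jr; have := XE (N - i)%N j; rewrite /N.
  move=> /(_ ltac:(lia) ltac:(lia) ltac:(lia)).
  have -> : (j < r)%N = true by lia.
  have -> : (r < r.*2 - i)%N = true by lia.
  have -> : (r.*2 - (r.*2 - i) = i)%N by lia.
  case: ifP => _; rewrite ?(X0 (r.*2 - i).+1); try lia.
    by case: ifP => ?; rewrite ?(X0 _ j.-1) ?add0r //; lia.
  by case: ifP => ?; rewrite ?(X0 _ j.-1) ?add0r //; lia.
(* Only entries within distance one of the two diagonals survive. *)
have X4 i j : (i <= N)%N -> (j <= N)%N -> i <> j ->
  ~ (odd i /\ (j = i.-1 \/ j = i.+1)) ->
  ~ ((i < r < j)%N /\ (i + j = N)%N) ->
  ~ ((i <= r <= j)%N /\ odd i /\ ((i + j).+1 = N \/ i + j = N.+1)%N) ->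
  X i j = 0.
  move=> iN jN h1 h2 h3 h4.
  have [ji|ij] := ltnP j./2 i./2; first exact: X0.
  have [ir|ri] := leqP i r; last first.
    have [jr|rj] := leqP j r; first by exfalso; lia.
    have -> : X i j = X (N - i)%N (N - j)%N.
      rewrite [RHS]X3 /N; try lia.
      by congr X; lia.
    by apply: X0; rewrite /N in iN jN *; lia.
  have [jr|rj] := ltnP j r; last first.
    have [c1|c1] := ltnP (N - j)./2 i./2; first exact: X1.
    have [c2|c2] := ltnP j./2 (N - i)./2; first by apply: X2 => //; rewrite rj.
    by exfalso; rewrite /N in h3 h4 c1 c2 jN iN *; lia.
  have [ir'|ri'] := ltnP i r; last by exfalso; lia.
  by rewrite X3 //; apply: X0; rewrite /N in iN jN *; lia.
have Xeo i j : (i <= N)%N -> (j <= N)%N -> ~~ odd i -> odd j -> X i j = 0.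
  by move=> iN jN ei oj; apply: X4 => //; rewrite /N; lia.
(* Diagonal entries agree across each top arc ([D1]) and each bottom arc ([D2]). The meander is a
   single path, so all of them equal [X 0 0], and trace zero makes them vanish since N + 1 is
   invertible. *)
have D1 a : (a < r)%N -> X a.*2 (a.*2) = X a.*2.+1 a.*2.+1.
  move=> ar; have := XE a.*2 a.*2.+1; rewrite /N.
  move=> /(_ ltac:(lia) ltac:(lia) ltac:(lia)).
  have -> : ~~ odd a.*2 && (a.*2 < r.*2)%N = true by lia.
  have -> : odd a.*2.+1 = true by lia.
  rewrite /= (Xeo (r.*2 - a.*2)%N) ?(Xeo a.*2 (r.*2 - a.*2.+1)%N); rewrite /N; try lia.
  by rewrite !if_same !addr0.
have D2 i : (i <= N)%N -> X i i = X (N - i)%N (N - i)%N.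
  move=> iN; have [ir|ri|->] := ltngtP i r; first exact: X3.
    by rewrite [RHS]X3 /N; rewrite /N in iN; try lia; congr X; lia.
  by rewrite /N; congr X; lia.
have D3 a : (a <= r)%N -> X a.*2 a.*2 = X 0%N 0%N.
  elim: a => // a IHa ar; rewrite -IHa ?(D1 a); try lia.
  rewrite [RHS]D2 /N; last lia.
  have -> : (r.*2 - a.*2.+1)%N = (r - a.+1).*2.+1 by lia.
  rewrite -D1; last lia.
  by rewrite D2 /N; [congr X; lia | lia].
have D4 i : (i <= N)%N -> X i i = X 0%N 0%N.
  move=> iN; have [oi|ei] := boolP (odd i); last first.
    by rewrite -(D3 i./2); rewrite /N in iN; [congr X; lia | lia].
  by rewrite -(D3 i./2) ?D1; rewrite /N in iN; try congr X; lia.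
have D i : (i <= N)%N -> X i i = 0.
  move=> iN; rewrite D4 //; move: trX.
  rewrite (eq_bigr (fun=> X 0%N 0%N)); last by move=> k _; rewrite D4 // -ltnS.
  rewrite sumr_const card_ord -mulr_natr => /eqP; rewrite mulf_eq0 (negPf N0) orbF.
  by move/eqP.
(* The equations at diagonal positions link the subdiagonal entries inside the blocks to the
   antidiagonal ones: [S1] and [S2] at the left end i of a bottom arc, [S3] and [S4] at its right
   end N - i. *)
have S1 i : (i < r)%N -> odd i -> X i i.-1 = - X i (N - i)%N.
  move=> ir oi; have := XE i i; rewrite /N.
  move=> /(_ ltac:(lia) ltac:(lia) ltac:(lia)).
  rewrite oi ir /=; have -> : (r < i)%N = false by lia.
  by rewrite add0r => /esym/eqP; rewrite addr_eq0 => /eqP.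
have S2 i : (i < r)%N -> ~~ odd i -> X i.+1 i = X i (N - i)%N.
  move=> ir oi; have := XE i i; rewrite /N.
  move=> /(_ ltac:(lia) ltac:(lia) ltac:(lia)).
  rewrite (negPf oi) ir /=; have -> : (r < i)%N = false by lia.
  have -> : (i < r.*2)%N = true by lia.
  by rewrite addr0 add0r.
have S3 i : (i < r)%N -> odd i -> X (N - i)%N (N - i).-1 = X i (N - i)%N.
  move=> ir oi; have := XE (N - i)%N (N - i)%N; rewrite /N.
  move=> /(_ ltac:(lia) ltac:(lia) ltac:(lia)).
  have -> : odd (r.*2 - i)%N = true by lia.
  have -> : (r < r.*2 - i)%N = true by lia.
  have -> : (r.*2 - i < r)%N = false by lia.
  have -> : (r.*2 - (r.*2 - i))%N = i by lia.
  by rewrite /= addr0 add0r.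
have S4 i : (0 < i < r)%N -> ~~ odd i -> X (N - i).+1 (N - i)%N = - X i (N - i)%N.
  move=> ir oi; have := XE (N - i)%N (N - i)%N; rewrite /N.
  move=> /(_ ltac:(lia) ltac:(lia) ltac:(lia)).
  have -> : odd (r.*2 - i)%N = false by lia.
  have -> : (r < r.*2 - i)%N = true by lia.
  have -> : (r.*2 - i < r)%N = false by lia.
  have -> : (r.*2 - i < r.*2)%N = true by lia.
  have -> : (r.*2 - (r.*2 - i))%N = i by lia.
  by rewrite /= addr0 => /eqP; rewrite addr_eq0 => /eqP.
(* Vertex N is alone in its block, hence an end of the path. Its diagonal equation has a single
   term, which starts the induction in [S]. *)
have S0 : X 0%N N = 0.
  have := XE N N; rewrite /N.
  move=> /(_ ltac:(lia) ltac:(lia) ltac:(lia)).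
  have -> : odd r.*2 = false by lia.
  have -> : (r < r.*2)%N = true by lia.
  have -> : (r.*2 < r)%N = false by lia.
  by rewrite ltnn subnn /= addr0 add0r.
(* Bottom arcs i and i + 1 meet in a common block, at their left ends for even i ([S2], [S1]) and at
   their right ends for odd i ([S3], [S4]). *)
have S i : (i < r)%N -> X i (N - i)%N = 0.
  elim: i => [|i IHi] ir; first by rewrite subn0.
  have IH := IHi (ltnW ir); have [oi|ei] := boolP (odd i).
    have := S4 i.+1; rewrite /= oi => /(_ ltac:(lia) isT).
    have -> : (N - i.+1).+1 = (N - i)%N by rewrite /N; lia.
    have -> : (N - i.+1)%N = (N - i).-1 by rewrite /N; lia.
    rewrite S3; try lia.
    by rewrite IH => /eqP; rewrite eq_sym oppr_eq0 => /eqP.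
  have := S1 i.+1 ir ltac:(lia); rewrite /= S2 ?IH; try lia.
  by move=> /eqP; rewrite eq_sym oppr_eq0 => /eqP.
have E i : (i <= N)%N -> odd i -> X i i.-1 = 0.
  move=> iN oi; have [ir|ri|ir] := ltngtP i r.
  - by rewrite S1 ?S ?oppr0.
  - have := S3 (N - i)%N; have -> : (N - (N - i) = i)%N by lia.
    rewrite /N in iN *; move=> -> //; try lia.
    have := S (r.*2 - i)%N; rewrite /N.
    have -> : (r.*2 - (r.*2 - i) = i)%N by lia.
    by apply; lia.
  - have := XE i i; rewrite /N.
    move=> /(_ ltac:(lia) ltac:(lia) ltac:(lia)).
    by rewrite oi ir ltnn /= !addr0 => <-.
(* [G] and [H] clear the entries next to the antidiagonal in odd rows, the third exception in
   [X4]. *)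
have G i : (i < r)%N -> odd i -> X i (N - i.+1)%N = 0.
  move=> ir oi; have := XE (N - i)%N (N - i.+1)%N; rewrite /N.
  move=> /(_ ltac:(lia) ltac:(lia) ltac:(lia)).
  have -> : odd (r.*2 - i)%N = true by lia.
  have -> : odd (r.*2 - i.+1)%N = false by lia.
  have -> : (r < r.*2 - i)%N = true by lia.
  have -> : (r.*2 - i.+1 < r)%N = false by lia.
  have -> : (r.*2 - (r.*2 - i))%N = i by lia.
  by rewrite /= !add0r.
have H i : (i <= r)%N -> odd i -> X i (N.+1 - i)%N = 0.
  move=> ir oi; have := XE i i.-1; rewrite /N.
  move=> /(_ ltac:(lia) ltac:(lia) ltac:(lia)).
  rewrite oi; have -> : odd i.-1 = false by lia.
  have -> : (r < i)%N = false by lia.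
  have -> : (i.-1 < r)%N = true by lia.
  have -> : (r.*2 - i.-1)%N = (r.*2.+1 - i)%N by lia.
  by rewrite /= !add0r => <-.
have GH i j : (i <= r <= j)%N -> (j <= N)%N -> odd i ->
   ((i + j).+1 = N \/ i + j = N.+1)%N -> X i j = 0.
  move=> irj jN oi [ijN|ijN]; rewrite /N in ijN.
    have [ir|ri] := ltnP i r.
      have -> : (j = N - i.+1)%N by rewrite /N; lia.
      exact: G.
    by exfalso; lia.
  have -> : (j = N.+1 - i)%N by rewrite /N; lia.
  by rewrite H //; lia.
move=> i j iN jN.
have [->|/eqP ij] := eqVneq i j; first exact: D.
have [->|/eqP iN1] := eqVneq j i.-1.
  have [oi|ei] := boolP (odd i); first exact: E.
  have [->|i0] := posnP i; first exact: D.
  by apply: X0; lia.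
have [[irj [oi e]]|hn] :
    let P := (i <= r <= j)%N /\ odd i /\ ((i + j).+1 = N \/ i + j = N.+1)%N in
    P \/ ~ P by rewrite /N /=; lia.
  exact: GH.
have [[irj e]|hn2] :
    let P := (i < r < j)%N /\ (i + j = N)%N in P \/ ~ P by rewrite /N /=; lia.
  have -> : j = (N - i)%N by lia.
  by apply: S; lia.
(* Point reflection turns [X i i.+1] into a subdiagonal entry treated by [E]; next to the centre r
   it falls under [GH] instead. *)
have [[oi ej]|hn3] : (odd i /\ j = i.+1) \/ ~ (odd i /\ j = i.+1) by lia.
  subst j; have [ir|ri] := ltnP i.+1 r.
    rewrite X3; try lia.
    have -> : (N - i.+1 = (N - i).-1)%N by lia.
    by apply: E; rewrite /N; lia.
  have [ir|ri'] := ltnP r i; last by apply: GH => //; rewrite /N; lia.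
  rewrite /N in jN iN *.
  have -> : X i i.+1 = X (N - i)%N (N - i.+1)%N.
    rewrite [RHS]X3 /N; try lia.
    by congr X; lia.
  have -> : (N - i.+1 = (N - i).-1)%N by lia.
  by apply: E; rewrite /N; lia.
by apply: X4 => //; lia.
Qed.

(** * Independence of the spectrum from the functional *)

Lemma deriv_prod_seq (R : comNzRingType) (I : eqType) (s : seq I)
    (p : I -> {poly R}) :
  uniq s ->
  (\prod_(i <- s) p i)^`() =
    \sum_(i <- s) (p i)^`() * \prod_(j <- s | j != i) p j.
Proof.
elim: s => [_|x s IHs /= /andP[xs us]]; first by rewrite !big_nil derivC.
rewrite !big_cons derivM IHs // eqxx /= mulr_sumr; congr (_ * _ + _).
  rewrite -[RHS]big_filter; congr bigop.
  by apply/esym/all_filterP/allP => y ys; apply: contraNneq xs => <-.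
rewrite !big_seq; apply: eq_bigr => i si; rewrite big_cons.
by rewrite ifT 1?mulrCA //; apply: contraNneq xs => ->.
Qed.

(** Jacobi's formula. The Leibniz rule in each permutation product differentiates one row at a time;
    expanding along that row gives a diagonal entry of A' adj A. *)
Lemma deriv_det (R : comNzRingType) n (A : 'M[{poly R}]_n) :
  (\det A)^`() = \tr (\adj A *m map_mx (@deriv R) A).
Proof.
rewrite mxtrace_mulC /mxtrace.
pose B (i : 'I_n) : 'M[{poly R}]_n :=
  \matrix_(k, l) if k == i then (A k l)^`() else A k l.
have detB i : \det (B i) = (map_mx (@deriv R) A *m \adj A) i i.
  rewrite (expand_det_row _ i) mxE; apply: eq_bigr => j _.
  rewrite !mxE eqxx; congr (_ * _); rewrite /cofactor; congr (_ * \det _).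
  by apply/matrixP => k l; rewrite !mxE eq_sym (negPf (neq_lift _ _)).
under eq_bigr do rewrite -detB.
rewrite exchange_big /= raddf_sum; apply: eq_bigr => s _ /=.
rewrite -signr_odd -mulr_sumr; case: (odd _).
  rewrite expr1 !mulN1r derivN; congr (- _); rewrite deriv_prod_seq ?index_enum_uniq //.
  apply: eq_bigr => i _; rewrite [RHS](bigD1 i) //= mxE eqxx; congr (_ * _).
  by apply: eq_bigr => j /negPf ji; rewrite mxE ji.
rewrite expr0 !mul1r deriv_prod_seq ?index_enum_uniq //.
apply: eq_bigr => i _; rewrite [RHS](bigD1 i) //= mxE eqxx; congr (_ * _).
by apply: eq_bigr => j /negPf ji; rewrite mxE ji.
Qed.

Lemma deriv_mulmx (R : comNzRingType) m n p (A : 'M[{poly R}]_(m, n))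
    (B : 'M[{poly R}]_(n, p)) :
  map_mx (@deriv R) (A *m B) =
    map_mx (@deriv R) A *m B + A *m map_mx (@deriv R) B.
Proof.
apply/matrixP => i j; rewrite !mxE raddf_sum -big_split /=.
by apply: eq_bigr => k _; rewrite derivM !mxE.
Qed.

(** A linear first-order equation, regular at 0 because [D.[0] != 0], is determined by its initial
    value. In degree n every term involves known zero coefficients of P except the one with factor
    (n + 1) P_(n+1), and n + 1 is invertible. *)
Lemma ode_unique (K : fieldType) (D P : {poly K}) (c : K) :
  [pchar K] =i pred0 -> D.[0] != 0 -> P.[0] = 0 ->
  D * P^`() = c *: (D^`() * P) -> P = 0.
Proof.
move=> K0 D0 P0 ode.
suff Pn n : forall i, (i <= n)%N -> P`_i = 0.
  by apply/polyP => i; rewrite coef0 (Pn i).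
elim: n => [|n IHn] i; first by rewrite leqn0 => /eqP ->; rewrite -horner_coef0.
rewrite leq_eqVlt ltnS => /predU1P[->|]; last exact: IHn.
have := congr1 (fun q : {poly K} => q`_n) ode.
rewrite coefZ !coefM [X in c * X]big1 ?mulr0; last first.
  by move=> j _; rewrite (IHn (n - j)%N) ?mulr0 // leq_subr.
rewrite big_ord_recl /= subn0 big1 ?addr0; last first.
  move=> j _; rewrite /= coef_deriv /bump /= add1n -subSn ?ltn_ord //.
  by rewrite subSS IHn ?mul0rn ?mulr0 // leq_subr.
move/eqP; rewrite coef_deriv mulf_eq0 -horner_coef0 (negPf D0) /=.
rewrite -mulr_natr mulf_eq0 => /orP[/eqP //|].
by move/pcharf0P: K0 => ->.
Qed.

(* [A i] is the matrix, acting on row vectors, of the adjoint of the i-th basis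
   vector. *)
Section StructureConstants.

Variables (R : comPzRingType) (m : nat) (A : 'I_m -> 'M[R]_m).

Definition admx (x : 'rV[R]_m) : 'M[R]_m := \sum_i x 0 i *: A i.

(** The Gram matrix of (x, y) |-> f [x, y], for the functional whose values on the basis are the
    entries of f. *)
Definition form_mx (f : 'cV[R]_m) : 'M[R]_m := \matrix_(i, j) (A i *m f) j 0.

Lemma admx_is_linear : linear admx.
Proof.
move=> c x y; rewrite /admx scaler_sumr -big_split /=; apply: eq_bigr => i _.
by rewrite !mxE scalerDl scalerA.
Qed.

HB.instance Definition _ :=
  GRing.isLinear.Build R 'rV[R]_m 'M[R]_m _ admx admx_is_linear.

Lemma mul_form_mx x f : x *m form_mx f = (admx x *m f)^T.
Proof.
apply/rowP => j; rewrite !mxE; under eq_bigr do rewrite !mxE mulr_sumr.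
rewrite exchange_big /=; apply: eq_bigr => k _; rewrite summxE mulr_suml.
by apply: eq_bigr => i _; rewrite mxE mulrA.
Qed.

(** Jacobi on basis vectors extends bilinearly. The row convention reverses products: [y *m admx x]
    is [x, y], and [admx y *m admx x] is ad x composed with ad y. *)
Lemma admx_bracket (jacobi : forall i j,
    admx (row j (A i)) = A j *m A i - A i *m A j) x y :
  admx (y *m admx x) = admx y *m admx x - admx x *m admx y.
Proof.
have E i : admx (y *m A i) = admx y *m A i - A i *m admx y.
  have -> : y *m A i = \sum_j y 0 j *: row j (A i) by rewrite mulmx_sum_row.
  rewrite linear_sum /= [in RHS]/admx mulmx_suml mulmx_sumr -sumrB.
  apply: eq_bigr => j _; rewrite linearZ /= jacobi -scalemxAl -scalemxAr.
  by rewrite scalerBr.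
have xE : admx x = \sum_i x 0 i *: A i by [].
rewrite xE [y *m _]mulmx_sumr [admx y *m _]mulmx_sumr [_ *m admx y]mulmx_suml linear_sum -sumrB /=.
apply: eq_bigr => i _; rewrite -!(scalemxAl, scalemxAr) linearZ /= E.
by rewrite scalerBr.
Qed.

End StructureConstants.

Lemma map_admx (R S : comPzRingType) (phi : {rmorphism R -> S}) m
    (A : 'I_m -> 'M[R]_m) x :
  map_mx phi (admx A x) = admx (fun i => map_mx phi (A i)) (map_mx phi x).
Proof.
rewrite /admx raddf_sum; apply: eq_bigr => i _ /=.
by rewrite map_mxZ mxE.
Qed.

Lemma map_form_mx (R S : comPzRingType) (phi : {rmorphism R -> S}) m
    (A : 'I_m -> 'M[R]_m) f :
  map_mx phi (form_mx A f) = form_mx (fun i => map_mx phi (A i)) (map_mx phi f).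
Proof.
by apply/matrixP => i j; rewrite [RHS]mxE -map_mxM [RHS]mxE mxE; congr (phi _); rewrite mxE.
Qed.

Lemma char_poly_principal (K : closedFieldType) m (A : 'I_m -> 'M[K]_m)
    (f0 f1 : 'cV[K]_m) (h0 h1 : 'rV[K]_m) :
  [pchar K] =i pred0 ->
  (forall i j, admx A (row j (A i)) = A j *m A i - A i *m A j) ->
  form_mx A f0 \in unitmx -> form_mx A f1 \in unitmx ->
  admx A h0 *m f0 = f0 -> admx A h1 *m f1 = f1 ->
  char_poly (admx A h0) = char_poly (admx A h1).
Proof.
move=> K0 jac u0 u1 h0E h1E.
pose C (p q : nat) (B : 'M[K]_(p, q)) : 'M[{poly K}]_(p, q) := map_mx polyC B.
pose AP i := C _ _ (A i).
pose d : 'cV_m := C _ _ (f1 - f0).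
pose f : 'cV_m := C _ _ f0 + 'X *: d.
pose M := form_mx AP f.
pose D := \det M.
(* The adjugate avoids fractions: [k] and [xi] are D times the principal element of f and D times
   the element representing d. *)
pose k : 'rV_m := f^T *m \adj M.
pose xi : 'rV_m := d^T *m \adj M.
have jacP i j : admx AP (row j (AP i)) = AP j *m AP i - AP i *m AP j.
  by rewrite /AP /C -map_row -map_admx jac map_mxB !map_mxM.
have kE : admx AP k *m f = D *: f.
  apply: trmx_inj; rewrite -mul_form_mx -mulmxA mul_adj_mx mul_mx_scalar.
  by rewrite linearZ.
have xiE : admx AP xi *m f = D *: d.
  apply: trmx_inj; rewrite -mul_form_mx -mulmxA mul_adj_mx mul_mx_scalar.
  by rewrite linearZ.
pose dv p q (B : 'M[{poly K}]_(p, q)) := map_mx (@deriv K) B.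
have dvC p q (B : 'M_(p, q)) : dv _ _ (C _ _ B) = 0.
  by apply/matrixP => i j; rewrite !mxE derivC.
have dvZ p q (a : {poly K}) (B : 'M_(p, q)) :
    dv _ _ (a *: B) = a^`() *: B + a *: dv _ _ B.
  by apply/matrixP => i j; rewrite !mxE derivM.
have dvf : dv _ _ f = d.
  rewrite /dv /f raddfD /= -/(dv _ _ _) dvC add0r -/(dv _ _ _) dvZ dvC.
  by rewrite derivX scale1r scaler0 addr0.
have dvad x : dv _ _ (admx AP x) = admx AP (dv _ _ x).
  rewrite /admx /dv raddf_sum; apply: eq_bigr => i _ /=.
  by rewrite -/(dv _ _ _) dvZ dvC scaler0 addr0 mxE.
have evf s : map_mx (horner_eval s) f = f0 + s *: (f1 - f0).
  apply/colP => i; by rewrite !mxE /horner_eval !hornerE.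
have evA s i : map_mx (horner_eval s) (AP i) = A i.
  by apply/matrixP => a b; rewrite !mxE /horner_eval hornerC.
have evad s x : map_mx (horner_eval s) (admx AP x)
    = admx A (map_mx (horner_eval s) x).
  by rewrite map_admx /admx; apply: eq_bigr => i _; rewrite evA.
have evM s : map_mx (horner_eval s) M = form_mx A (f0 + s *: (f1 - f0)).
  rewrite /M map_form_mx evf; apply/matrixP => i j.
  by rewrite !mxE; apply: eq_bigr => l _; rewrite evA.
have evD s : D.[s] = \det (form_mx A (f0 + s *: (f1 - f0))).
  by rewrite -evM det_map_mx.
have fs0 : f0 + 0 *: (f1 - f0) = f0 by rewrite scale0r addr0.
have fs1 : f0 + 1 *: (f1 - f0) = f1 by rewrite scale1r addrC subrK.
have D0 : D.[0] != 0 by rewrite evD fs0 -unitfE -unitmxE.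
have D1 : D.[1] != 0 by rewrite evD fs1 -unitfE -unitmxE.
have Dnz : D != 0 by apply: contraNneq D0 => ->; rewrite horner0.
have Minj (x : 'rV_m) : admx AP x *m f = 0 -> x = 0.
  move=> x0; have : D *: x = 0.
    by rewrite -mul_mx_scalar -mul_mx_adj mulmxA mul_form_mx x0 trmx0 mul0mx.
  move=> Dx0; apply/rowP => i; move/rowP/(_ i): Dx0; rewrite !mxE => /eqP.
  by rewrite mulf_eq0 (negPf Dnz) => /eqP.
(* The Lax equation, cleared of denominators: h = k / D and y = xi / D. *)
have lax : D *: dv _ _ k = D^`() *: k - k *m admx AP xi.
  (* By nondegeneracy it suffices to compare the functionals that the two sides induce through f;
     that comparison is the derivative of [kE] multiplied by D. *)
  apply/eqP; rewrite -subr_eq0; apply/eqP/Minj.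
  clearbody f.
  have := congr1 (dv _ _) kE; rewrite /dv deriv_mulmx -!/(dv _ _ _) dvZ dvf dvad.
  move=> /(congr1 (GRing.scale D)); rewrite !scalerDr => /(canRL (addrK _)) kE'.
  rewrite linearB linearZ linearB linearZ /= admx_bracket // !mulmxBl.
  rewrite -!scalemxAl kE' -!mulmxA kE xiE -!scalemxAr xiE.
  rewrite !scalerA [D * _]mulrC opprB.
  set a := (_ * _) *: f; set b := (_ * _) *: d; set c := D *: _.
  rewrite -[RHS](subrr (a + b - c)); congr (_ + _).
  by rewrite opprB opprD [- a - b]addrC addrA.
have evk s h : form_mx A (f0 + s *: (f1 - f0)) \in unitmx ->
    admx A h *m (f0 + s *: (f1 - f0)) = f0 + s *: (f1 - f0) ->
    map_mx (horner_eval s) k = D.[s] *: h.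
  move=> us hE; apply: (can_inj (mulmxK us)); apply: trmx_inj.
  rewrite !mul_form_mx !trmxK linearZ /= -scalemxAl hE.
  by rewrite -evf -evad -map_mxM kE map_mxZ.
(* Were the characteristic polynomials different, their difference would have a nonroot z; equality
   of the values at z is what remains to prove. *)
apply/eqP; rewrite -subr_eq0; apply/negPn/negP => /closed_nonrootP[z].
rewrite /root hornerD hornerN subr_eq0 => /negP; apply; apply/eqP.
(* [N] is the characteristic polynomial of ad (k / D) at z, cleared of denominators by the factor D
   ^ m. *)
pose L := (z *: D)%:M - admx AP k.
pose N := \det L.
have evN s h : form_mx A (f0 + s *: (f1 - f0)) \in unitmx ->
    admx A h *m (f0 + s *: (f1 - f0)) = f0 + s *: (f1 - f0) ->
    N.[s] = D.[s] ^+ m * (char_poly (admx A h)).[z].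
  move=> us hE.
  have -> : N.[s] = \det (map_mx (horner_eval s) L) by rewrite det_map_mx.
  have -> : (char_poly (admx A h)).[z]
      = \det (map_mx (horner_eval z) (char_poly_mx (admx A h))).
    by rewrite det_map_mx.
  rewrite -detZ; congr (\det _).
  rewrite /L !map_mxB /= evad (evk s h) // linearZ /= scalerBr; congr (_ - _).
    apply/matrixP => i j; rewrite !mxE /horner_eval; case: (i == j).
      by rewrite /= !mulr1n !hornerE mulrC.
    by rewrite /= !mulr0n !hornerE.
  by apply/matrixP => i j; rewrite !mxE /horner_eval hornerC.
(* By [lax], L varies by a scaling and a commutator with [admx AP xi]. Against adj L the commutator
   has trace zero, so only the scaling survives in [dN]. *)
have dL : D *: dv _ _ L = D^`() *: L + admx AP xi *m L - L *m admx AP xi.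
  have -> : dv _ _ L = (z *: D^`())%:M - admx AP (dv _ _ k).
    rewrite -dvad /dv /L map_mxB; congr (_ - _).
    apply/matrixP => i j; rewrite !mxE; case: (i == j).
      by rewrite /= !mulr1n derivZ.
    by rewrite /= !mulr0n derivC.
  have := congr1 (admx AP) lax; rewrite linearZ linearB linearZ /= admx_bracket //.
  rewrite scalerBr => ->.
  rewrite /L mulmxBl mulmxBr scalerBr scalar_mxC !scale_scalar_mx.
  rewrite -!scalerAr [D * _]mulrC.
  move: (D^`() *: _) (admx AP xi *m admx AP k) (_ *m admx AP xi) (_%:M *m _) => a b c e.
  rewrite opprB -!addrA; congr (_ + _).
  rewrite opprB [LHS]addrA [LHS]addrC; congr (_ + _).
  by rewrite [RHS]addrC -addrA subrK addrC.
have dN : D * N^`() = m%:R *: (D^`() * N).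
  rewrite /N deriv_det -/(dv _ _ _) -mxtraceZ scalemxAr dL.
  rewrite mulmxBr mulmxDr linearB linearD /= !mulmxA mul_adj_mx.
  rewrite [\tr (_ *m _ *m L)]mxtrace_mulC !mulmxA mul_mx_adj addrK.
  rewrite -scalemxAr mul_adj_mx linearZ /= mxtrace_scalar.
  by rewrite mulrnAr -mulr_natl -mul_polyC rmorph_nat.
(* [N] and D ^ m satisfy the same equation; W is the combination of them that vanishes at 0. *)
pose W := D.[0] ^+ m *: N - N.[0] *: D ^+ m.
have dDm : D * (D ^+ m)^`() = m%:R *: (D^`() * D ^+ m).
  rewrite deriv_exp -mul_polyC rmorph_nat mulr_natl mulrnAr.
  by case: (m) => [|m']; rewrite ?mulr0n // mulrCA exprS.
have W0 : W = 0.
  apply: (@ode_unique _ D _ m%:R) => //; first by rewrite /W !hornerE mulrC subrr.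
  rewrite /W derivB !derivZ !mulrBr scalerBr -!scalerAr dN dDm !scalerA.
  by rewrite ![_ * m%:R]mulrC.
have e0 : N.[0] = D.[0] ^+ m * (char_poly (admx A h0)).[z].
  by apply: evN; rewrite fs0.
have e1 : N.[1] = D.[1] ^+ m * (char_poly (admx A h1)).[z].
  by apply: evN; rewrite fs1.
have := congr1 (fun p : {poly K} => p.[1]) W0; rewrite /W !hornerE.
rewrite e0 e1 => W1.
have nz : D.[0] ^+ m * D.[1] ^+ m != 0 by rewrite mulf_neq0 // expf_neq0.
apply/esym/(mulfI nz)/eqP; rewrite -subr_eq0 -[X in _ == X]W1.
by apply/eqP; ring.
Qed.

(** * Characteristic polynomials and eigenbases *)

Lemma char_poly_conj (F : fieldType) p q (P : 'M[F]_(p, q)) (A : 'M_p) (B : 'M_q) :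
  row_free P -> row_full P -> P *m B = A *m P -> char_poly A = char_poly B.
Proof.
rewrite /row_free /row_full => /eqP P1 /eqP P2.
(* In use the two sizes are #|I| and [\dim {:V}], whose equality is itself a consequence of the
   invertibility of P. *)
have e : p = q by rewrite -P1.
subst q => PB; have uP : \det P != 0.
  by rewrite -unitfE -unitmxE -row_free_unit /row_free P1.
have uP' : \det (map_mx polyC P) != 0 by rewrite det_map_mx polyC_eq0.
apply: (mulIf uP'); rewrite [RHS]mulrC -!det_mulmx; congr (\det _).
rewrite /char_poly_mx mulmxBl mulmxBr -!map_mxM PB.
by rewrite mul_scalar_mx mul_mx_scalar.
Qed.

Lemma perm_eigenvalues (C : closedFieldType) (V : vectType C) (f f' : 'End(V)) :
  char_poly_end f = char_poly_end f' -> perm_eq (eigenvalues f) (eigenvalues f').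
Proof. by move=> eff'; apply: prod_XsubC_eq; rewrite -!eigenvaluesE. Qed.

Lemma eigenvalues_eigenbasis (C : closedFieldType) (V : vectType C)
    (f : 'End(V)) (I : finType) (X : I -> V) (lam : I -> C) :
  (forall c : I -> C, \sum_i c i *: X i = 0 -> forall i, c i = 0) ->
  (forall v, exists c : I -> C, v = \sum_i c i *: X i) ->
  (forall i, f (X i) = lam i *: X i) ->
  perm_eq (eigenvalues f) [seq lam i | i <- enum I].
Proof.
move=> freeX spanX eigX; pose e := vbasis {:V}.
have eb : basis_of {:V} e := vbasisP _.
pose P : 'M[C]_(#|I|, \dim {:V}) := \matrix_i rVof e (X (enum_val i)).
have sumP (u : 'rV_#|I|) :
    u *m P = rVof e (\sum_i u 0 (enum_rank i) *: X i).
  rewrite mulmx_sum_row linear_sum [RHS](reindex _ (onW_bij _ (enum_val_bij I))) /=.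
  by apply: eq_bigr => i _; rewrite rowK linearZ enum_valK.
have Pfree : row_free P.
  apply: inj_row_free => u; rewrite sumP => /eqP; rewrite rVof_eq0 // => /eqP.
  by move=> /freeX u0; apply/rowP => i; rewrite mxE -(enum_valK i) u0.
have Pfull : row_full P.
  rewrite -sub1mx; apply/row_subP => i; rewrite rowE mulmx1.
  have [c vE] := spanX (vecof e (delta_mx 0 i)).
  apply/submxP; exists (\row_j c (enum_val j)); rewrite sumP.
  rewrite -[LHS](vecofK eb) vE; congr (rVof _ _).
  by apply: eq_bigr => j _; rewrite mxE enum_rankK.
apply: prod_XsubC_eq; rewrite -eigenvaluesE /char_poly_end -/e.
set M := mxof e e f.
have PM : P *m M = diag_mx (\row_i lam (enum_val i)) *m P.
  apply/row_matrixP => i; rewrite row_mul rowK -rVof_app // eigX linearZ /=.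
  by rewrite row_mul row_diag_mx -scalemxAl -rowE rowK mxE.
rewrite -(char_poly_conj Pfree Pfull PM) char_poly_trig; last first.
  by rewrite is_diag_mx_is_trig ?diag_mx_is_diag.
rewrite big_map big_enum [RHS](reindex _ (onW_bij _ (enum_val_bij I))) /=.
by apply: eq_bigr => i _; rewrite !mxE eqxx.
Qed.

(** * Adjoint representation, functionals and principal elements in coordinates *)

Section LieAlgebra.

Variables (K : fieldType) (n : nat) (g : {vspace 'M[K]_n}).
Hypothesis g_lie : forall x y, x \in g -> y \in g -> lie_mx x y \in g.
Implicit Types (x y z : subvs_of g) (F : 'Hom(subvs_of g, K^o)).

Lemma vsval_lie x y : vsval (lie x y) = lie_mx (vsval x) (vsval y).
Proof. by rewrite vsprojK // g_lie ?subvsP. Qed.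

Lemma lie_anti x y : lie x y = - lie y x.
Proof.
by apply: val_inj; rewrite /= !vsval_lie /lie_mx opprB.
Qed.

Lemma lie_jacobi x y z : lie x (lie y z) = lie (lie x y) z + lie y (lie x z).
Proof.
apply: val_inj; rewrite /= !vsval_lie /lie_mx.
rewrite !(mulmxBl, mulmxBr) !mulmxA.
do 9?[move: (_ *m _) => ?].
by apply/matrixP => i j; rewrite !mxE; ring.
Qed.

Lemma ad_is_linear : linear (@ad K n g).
Proof.
move=> c x y; apply/lfunP => z; rewrite !lfunE /= !lfunE /= !lfunE /=.
by rewrite lie_anti [lie x z]lie_anti [lie y z]lie_anti linearP opprD scalerN.
Qed.

HB.instance Definition _ :=
  GRing.isLinear.Build K (subvs_of g) 'End(subvs_of g) _ (@ad K n g) ad_is_linear.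

Lemma lieZl c x y : lie (c *: x) y = c *: lie x y.
Proof. by rewrite lie_anti linearZ [lie x y]lie_anti scalerN. Qed.

Lemma lie_suml (I : finType) (X : I -> subvs_of g) y :
  lie (\sum_i X i) y = \sum_i lie (X i) y.
Proof.
by rewrite lie_anti linear_sum -sumrN; apply: eq_bigr => i _; rewrite -lie_anti.
Qed.

Let e := vbasis {: subvs_of g}.
Let eb : basis_of {: subvs_of g} e := vbasisP _.

Definition ad_mx (i : 'I_(\dim {: subvs_of g})) := mxof e e (ad e`_i).
Definition functional_mx F : 'cV_(\dim {: subvs_of g}) := \col_i F e`_i.

Lemma admx_rVof x : admx ad_mx (rVof e x) = mxof e e (ad x).
Proof.
rewrite -{2}(rVofK eb x) /vecof !linear_sum; apply: eq_bigr => i _.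
by rewrite !linearZ.
Qed.

Lemma mul_functional_mx F x : (rVof e x *m functional_mx F) 0 0 = F x.
Proof.
rewrite -{2}(rVofK eb x) /vecof linear_sum mxE; apply: eq_bigr => i _.
by rewrite linearZ /= !mxE.
Qed.

Lemma ad_mx_jacobi i j :
  admx ad_mx (row j (ad_mx i)) = ad_mx j *m ad_mx i - ad_mx i *m ad_mx j.
Proof.
have -> : row j (ad_mx i) = rVof e (lie e`_i e`_j).
  by rewrite rowE -(rVofE eb) -rVof_app // lfunE.
rewrite admx_rVof; apply/row_matrixP => k; rewrite linearB /= !row_mul.
rewrite !rowE -!(rVofE eb) -!rVof_app // !lfunE /= -linearB; congr (rVof _ _).
by rewrite (lie_jacobi e`_i) addrK.
Qed.

Lemma form_mxE F x y :
  (rVof e x *m form_mx ad_mx (functional_mx F) *m (rVof e y)^T) 0 0 = F (lie x y).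
Proof.
rewrite mul_form_mx admx_rVof -trmx_mul mulmxA -rVof_app // mxE lfunE.
by rewrite mul_functional_mx.
Qed.

Lemma frobenius_unitmx F :
  frobenius_functional F -> form_mx ad_mx (functional_mx F) \in unitmx.
Proof.
move=> frobF; rewrite -row_free_unit; apply: inj_row_free => v v0.
rewrite -(vecofK eb v); suff -> : vecof e v = 0 by rewrite linear0.
by apply: frobF => y; rewrite -form_mxE vecofK // v0 mul0mx mxE.
Qed.

Lemma principal_elementP F h :
  principal_element F h <->
  admx ad_mx (rVof e h) *m functional_mx F = functional_mx F.
Proof.
rewrite admx_rVof; split=> [hF|hF x].
  apply/colP => i; have := mul_functional_mx F (ad h e`_i).
  by rewrite (@rVof_app _ _ _ e e eb) (rVofE eb) -mulmxA -rowE mxE lfunE /= hF => ->; rewrite mxE.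
rewrite -(mul_functional_mx F x) -hF mulmxA -rVof_app // lfunE.
by rewrite mul_functional_mx.
Qed.

Lemma principal_element_exists F :
  frobenius_functional F -> exists h, unique (principal_element F) h.
Proof.
move=> frobF; have uF := frobenius_unitmx frobF.
pose M := form_mx ad_mx (functional_mx F).
exists (vecof e ((functional_mx F)^T *m invmx M)); split=> [|h hF].
  apply/principal_elementP; rewrite vecofK //; apply: trmx_inj.
  by rewrite -mul_form_mx mulmxKV.
move/principal_elementP: hF => /(congr1 trmx); rewrite -mul_form_mx => <-.
by rewrite mulmxK // rVofK.
Qed.

(* Pairing of the eigenspaces of [ad h] for [c] and [1 - c]: a permutation
   contributing a nonzero term to the determinant of the Gram matrix of F. *)
Lemma principal_eigenbasis_duality F h (I : finType) (X : I -> subvs_of g)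
    (lam : I -> K) :
  frobenius_functional F -> principal_element F h ->
  (forall c : I -> K, \sum_i c i *: X i = 0 -> forall i, c i = 0) ->
  (forall v, exists c : I -> K, v = \sum_i c i *: X i) ->
  (forall i, lie h (X i) = lam i *: X i) ->
  exists s : {perm I}, forall i, lam i + lam (s i) = 1.
Proof.
move=> frobF hF freeX spanX eigX.
pose B : 'M[K]_#|I| := \matrix_(i, j) F (lie (X (enum_val i)) (X (enum_val j))).
have detB : \det B != 0.
  rewrite -unitfE -unitmxE -row_free_unit; apply: inj_row_free => v v0.
  have: \sum_i v 0 (enum_rank i) *: X i = 0.
    apply: frobF => y; have [c ->] := spanX y.
    rewrite linear_sum linear_sum big1 // => j _; rewrite !linearZ /=.
    move/rowP/(_ (enum_rank j)): v0; rewrite !mxE lie_suml linear_sum => v0.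
    rewrite (reindex _ (onW_bij _ (enum_val_bij I))) /=.
    rewrite (eq_bigr (fun i => v 0 i * B i (enum_rank j))) ?v0 ?scaler0 // => i _.
    by rewrite lieZl linearZ mxE enum_rankK enum_valK.
  by move/freeX => vz; apply/rowP => i; rewrite mxE -(enum_valK i) vz.
(* F [h, [x, y]] = F [x, y], while by Jacobi ad h multiplies [X i, X j] by the sum of the two
   eigenvalues. *)
have Blam i j : (lam (enum_val i) + lam (enum_val j) - 1) * B i j = 0.
  rewrite mxE mulrBl mul1r -[X in _ - X]hF lie_jacobi !eigX.
  by rewrite lieZl !linearD !linearZ /= mulrDl subrr.
have [s sB] : exists s : 'S_#|I|, \prod_i B i (s i) != 0.
  apply/existsP; apply: contraNT detB => /existsPn noS.
  apply/eqP; rewrite /determinant big1 // => s _.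
  by move: (noS s); rewrite negbK => /eqP ->; rewrite mulr0.
have sinj : injective (fun i => enum_val (s (enum_rank i))).
  by move=> i j /enum_val_inj/perm_inj/enum_rank_inj.
exists (perm sinj) => i; rewrite permE.
have /prodf_neq0/(_ (enum_rank i) isT) Bi := sB.
move/eqP: (Blam (enum_rank i) (s (enum_rank i))); rewrite mulf_eq0 (negPf Bi) orbF.
by rewrite enum_rankK subr_eq0 => /eqP.
Qed.

End LieAlgebra.

Lemma char_poly_end_principal (C : closedFieldType) n (g : {vspace 'M[C]_n})
    (F0 F1 : 'Hom(subvs_of g, C^o)) h0 h1 :
  [pchar C] =i pred0 ->
  (forall x y, x \in g -> y \in g -> lie_mx x y \in g) ->
  frobenius_functional F0 -> frobenius_functional F1 ->
  principal_element F0 h0 -> principal_element F1 h1 ->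
  char_poly_end (ad h0) = char_poly_end (ad h1).
Proof.
move=> C0 g_lie frob0 frob1 /(principal_elementP g_lie) e0 /(principal_elementP g_lie) e1.
rewrite /char_poly_end -!(admx_rVof g_lie).
apply: char_poly_principal e0 e1 => //; first exact: ad_mx_jacobi.
  exact: frobenius_unitmx.
exact: frobenius_unitmx.
Qed.

(** * The seaweed as a parabolic algebra *)

Lemma mem_span_delta (K : fieldType) n (P : pred 'I_n) (v : 'cV[K]_n) :
  reflect (forall i, ~~ P i -> v i 0 = 0)
    (v \in <<[seq (delta_mx i 0 : 'cV[K]_n)%R | i <- enum 'I_n & P i]>>%VS).
Proof.
set s := map _ _; apply: (iffP idP) => [vs i nPi|v0].
  rewrite (coord_span (X := in_tuple s) vs) summxE big1 // => j _; rewrite mxE.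
  have: (in_tuple s)`_j \in s by rewrite mem_nth.
  case/mapP => k; rewrite mem_filter => /andP[Pk _] ->; rewrite mxE.
  by case: eqP nPi => [->|_ _]; rewrite ?Pk ?mulr0.
rewrite (matrix_sum_delta v); apply: memv_suml => i _.
rewrite big_ord1; have [Pi|/v0 ->] := boolP (P i); last by rewrite scale0r mem0v.
apply/memvZ/memv_span/mapP; exists i; rewrite // mem_filter Pi /=.
by rewrite mem_enum.
Qed.

Lemma mem_lower_span (K : fieldType) n k (v : 'cV[K]_n) :
  reflect (forall i : 'I_n, (k <= i)%N -> v i 0 = 0) (v \in lower_span K n k).
Proof.
apply: (iffP (mem_span_delta _ _)) => v0 i ki; apply: v0; first by rewrite -leqNgt.
by rewrite leqNgt.
Qed.

Lemma mem_upper_span (K : fieldType) n k (v : 'cV[K]_n) :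
  reflect (forall i : 'I_n, (i < k)%N -> v i 0 = 0) (v \in upper_span K n k).
Proof.
apply: (iffP (mem_span_delta _ _)) => v0 i ki; apply: v0; first by rewrite -ltnNge.
by rewrite ltnNge.
Qed.

Lemma sumn_take_flag r k :
  (k <= r)%N -> sumn (take k (nseq r 2%N ++ [:: 1%N])) = k.*2.
Proof.
move=> kr; rewrite take_cat size_nseq; case: ltngtP kr => // [kr _|-> _].
  by rewrite take_nseq ?sumn_nseq ?mul2n // ltnW.
by rewrite subnn take0 cats0 sumn_nseq mul2n.
Qed.

Lemma mxtrace_mul_delta (R : pzSemiRingType) n (A : 'M[R]_n) i j :
  \tr (A *m delta_mx i j) = A j i.
Proof.
rewrite /mxtrace (bigD1 j) //= mxE (bigD1 i) //= mxE !eqxx mulr1 !big1 ?addr0 //.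
  by move=> k kj; rewrite mxE big1 // => l _; rewrite mxE (negPf kj) andbF mulr0.
by move=> k ki; rewrite mxE (negPf ki) mulr0.
Qed.

Section Parabolic.

Variables (K : fieldType) (r : nat).
Local Notation N := r.*2.
Local Notation n := N.+1.

Definition parabolic : {vspace 'M[K]_n} :=
  seaweed K n (nseq r 2%N ++ [:: 1%N]) [:: n].
Local Notation g := parabolic.

(** The bottom composition has one part, so its flag is trivial and only block triangularity for the
    top flag remains. *)
Lemma mem_parabolic (x : 'M[K]_n) :
  x \in g <-> \tr x = 0 /\ (forall i j : 'I_n, (j./2 < i./2)%N -> x i j = 0).
Proof.
rewrite mem_seaweed size_cat size_nseq addn1 /=; split=> [[trx xV _]|[trx x0]].
  split=> // i j ji; have jr : (j./2.+1 <= r)%N by have := ltn_ord i; lia.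
  (* e_j is tested in the smallest flag member containing it, the one that ends with the block of
     j. *)
  have := xV j./2.+1 (leqW jr) (delta_mx j 0); rewrite /flagV sumn_take_flag //.
  move=> /(_ _)/mem_lower_span/(_ i); rewrite -colE mxE; apply; last by lia.
  by apply/mem_lower_span => k jk; rewrite mxE; case: eqP => // kj; move: jk; rewrite kj; lia.
split=> // [k kr v|k kr v].
  rewrite leq_eqVlt ltnS in kr; case/predU1P: kr => [->|kr].
    move=> _; rewrite /flagV take_oversize ?size_cat ?size_nseq ?addn1 //.
    rewrite sumn_cat sumn_nseq mul2n /= addn0 addn1.
    by apply/mem_lower_span => i; rewrite leqNgt ltn_ord.
  rewrite /flagV sumn_take_flag // => /mem_lower_span v0.
  apply/mem_lower_span => i ki; rewrite mxE big1 // => j _.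
  have [jk|kj] := ltnP j k.*2; last by rewrite v0 ?mulr0.
  by rewrite x0 ?mul0r //; lia.
case: k kr => [|[|//]] _; rewrite /flagW /= ?addn0.
  by move=> _; apply/mem_upper_span.
move=> /mem_upper_span v0; have -> : v = 0.
  by apply/colP => i; rewrite mxE v0.
by rewrite mulmx0 mem0v.
Qed.

Lemma parabolic_lie x y : x \in g -> y \in g -> lie_mx x y \in g.
Proof. exact: lie_mx_seaweed. Qed.

(* Trace duality transposes: the entry (u, v) is 1 when x_vu is one of the terms
   of F, that is for the top arcs (v, u) = (2k+1, 2k) and the bottom arcs
   v = 2r - u < u. *)
Definition meander_mx : 'M[K]_n :=
  \matrix_(u, v) ((~~ odd u && (v == u.+1 :> nat))%:R
                  + ((r < u)%N && (v == N - u :> nat)%N)%:R).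

Definition meander_fun (x : subvs_of g) : K^o := \tr (meander_mx *m vsval x).

Lemma meander_fun_is_linear : linear meander_fun.
Proof.
move=> c x y; rewrite /meander_fun.
have -> : vsval (c *: x + y) = c *: vsval x + vsval y by exact: linearP.
by rewrite mulmxDr -scalemxAr linearP.
Qed.

HB.instance Definition _ :=
  GRing.isLinear.Build K (subvs_of g) K^o _ meander_fun meander_fun_is_linear.

Definition meander_functional : 'Hom(subvs_of g, K^o) := linfun meander_fun.

(** Invariance of the trace form, tr (A [x, y]) = tr ([A, x] y), turns the kernel of the form into
    equations on the entries of [A, x]. *)
Lemma meander_functional_lie x y :
  meander_functional (lie x y) = \tr (lie_mx meander_mx (vsval x) *m vsval y).
Proof.
rewrite lfunE /= /meander_fun vsval_lie; last exact: parabolic_lie.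
rewrite /lie_mx mulmxBr mulmxBl 2!raddfB /= !mulmxA; congr (_ - _).
by rewrite [RHS]mxtrace_mulC mulmxA mxtrace_mulC !mulmxA mxtrace_mulC !mulmxA.
Qed.

(** Indexing by naturals with default 0 allows [u.+1] and [N - u] as indices and keeps block
    triangularity valid at all indices, as [meander_kernel] asks. *)
Definition entry (x : 'M[K]_n) i j : K :=
  if (i <= N)%N && (j <= N)%N then x (inord i) (inord j) else 0.

Lemma entryE (x : 'M[K]_n) (i j : 'I_n) : x i j = entry x i j.
Proof.
by rewrite /entry; have := ltn_ord i; have := ltn_ord j; rewrite !ltnS => -> ->;
  rewrite !inord_val.
Qed.

Lemma sum_pick (b : bool) k (G : nat -> K) :
  (k <= N)%N ->
  \sum_(w < n) (b && (w == k :> nat))%:R * G w = if b then G k else 0.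
Proof.
move=> kN; case: b => /=; last by rewrite big1 // => w _; rewrite mul0r.
rewrite (bigD1 (Ordinal (kN : (k < n)%N))) //= eqxx mul1r big1 ?addr0 // => w.
by rewrite -val_eqE /= => /negPf ->; rewrite mul0r.
Qed.

Lemma mul_meander_mx x (u v : 'I_n) :
  (meander_mx *m x) u v =
    (if ~~ odd u && (u < N)%N then entry x u.+1 v else 0)
    + (if (r < u)%N then entry x (N - u) v else 0).
Proof.
rewrite mxE; under eq_bigr do rewrite mxE entryE mulrDl.
rewrite big_split /= (sum_pick (r < u)%N (fun w => entry x w v)) ?leq_subr //.
congr (_ + _); have uN := ltn_ord u; rewrite ltnS leq_eqVlt in uN.
case/predU1P: uN => [->|uN].
  rewrite ltnn andbF big1 // => w _; rewrite (ltn_eqF (ltn_ord w)).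
  by rewrite andbF mul0r.
by rewrite (sum_pick _ (fun w => entry x w v)) // uN andbT.
Qed.

Lemma mul_mx_meander x (u v : 'I_n) :
  (x *m meander_mx) u v =
    (if odd v then entry x u v.-1 else 0)
    + (if (v < r)%N then entry x u (N - v) else 0).
Proof.
have vN := ltn_ord v.
rewrite mxE -(sum_pick (odd v) (entry x u)); last by lia.
rewrite -(sum_pick (v < r)%N (entry x u)) ?leq_subr // -big_split /=.
apply: eq_bigr => w _; have wN := ltn_ord w.
rewrite mxE entryE mulrC mulrDl; congr (_%:R * _ + _%:R * _); lia.
Qed.

Hypothesis K0 : [pchar K] =i pred0.
Hypothesis r_gt0 : (0 < r)%N.

Lemma n_neq0 : n%:R != 0 :> K.
Proof. by move/pcharf0P: K0 => ->. Qed.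

(** Scalar matrices are central, so this projection to trace zero leaves all commutators
    unchanged. *)
Definition traceless (x : 'M[K]_n) : 'M[K]_n := x - (\tr x / n%:R)%:M.

Lemma traceless_parabolic (x : 'M[K]_n) :
  (forall i j : 'I_n, (j./2 < i./2)%N -> x i j = 0) -> traceless x \in g.
Proof.
move=> x0; apply/mem_parabolic; split=> [|i j ji].
  by rewrite linearB /= mxtrace_scalar -[X in _ - X]mulr_natr divfK ?n_neq0 // subrr.
rewrite !mxE x0 //; case: eqP => [ij|_]; last by rewrite subr0.
by move: ji; rewrite ij ltnn.
Qed.

Lemma lie_mx_traceless x y : lie_mx x (traceless y) = lie_mx x y.
Proof.
by rewrite /lie_mx mulmxBr mulmxBl scalar_mxC opprB addrA subrK.
Qed.

Lemma meander_frobenius : frobenius_functional meander_functional.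
Proof.
move=> x xF; have /mem_parabolic[trx x0] := subvsP x.
have XE (u v : 'I_n) : (v./2 <= u./2)%N ->
    (meander_mx *m vsval x) u v = (vsval x *m meander_mx) u v.
  move=> vu; have yg : traceless (delta_mx v u) \in g.
    apply: traceless_parabolic => i j ji; rewrite mxE.
    by case: eqP => //= iv; case: eqP => // ju; move: ji; rewrite iv ju ltnNge vu.
  have := xF (Subvs yg); rewrite meander_functional_lie /=.
  rewrite mulmxBr linearB /= mul_mx_scalar linearZ /= [\tr (lie_mx _ _)]linearB /=.
  rewrite [\tr (meander_mx *m _)]mxtrace_mulC subrr mulr0 subr0.
  by rewrite mxtrace_mul_delta !mxE => /eqP; rewrite subr_eq0 => /eqP.
apply: val_inj => /=; apply/matrixP => i j; rewrite mxE entryE.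
apply: (@meander_kernel _ r) => //; rewrite -1?ltnS ?ltn_ord //.
- move=> {}i {}j ji; rewrite /entry; case: ifP => // /andP[iN jN].
  by apply: x0; rewrite !inordK.
- move=> u v uN vN vu; have := XE (inord u) (inord v).
  by rewrite mul_meander_mx mul_mx_meander !inordK //; apply.
- exact: n_neq0.
- by rewrite -[RHS]trx; apply: eq_bigr => k _; rewrite entryE.
Qed.

(** Chosen to rise by one from u to v along each arc x_vu of F: parity does this on top arcs, and
    the block indicator on bottom arcs, whose ends have equal parity and lie on opposite sides of
    r. *)
Definition level (i : nat) : nat := ((i./2 < uphalf r) + odd i)%N.

Definition level_mx : 'M[K]_n := diag_mx (\row_i (level i)%:R).

Lemma lie_level_mx x i j :
  lie_mx level_mx x i j = ((level i)%:R - (level j)%:R) * x i j.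
Proof.
by rewrite /lie_mx mul_diag_mx mul_mx_diag !mxE mulrBl [_ * (level j)%:R]mulrC.
Qed.

Lemma level_parabolic : traceless level_mx \in g.
Proof.
apply: traceless_parabolic => i j ji; rewrite !mxE.
by case: eqP => // ij; move: ji; rewrite ij ltnn.
Qed.

Definition principal : subvs_of g := Subvs level_parabolic.

Lemma lie_traceless_mx x y : lie_mx (traceless x) y = lie_mx x y.
Proof.
have lieN a b : lie_mx a b = - lie_mx b a :> 'M[K]_n by rewrite /lie_mx opprB.
by rewrite lieN lie_mx_traceless -lieN.
Qed.

Lemma meander_level (u v : 'I_n) :
  meander_mx u v != 0 -> level v = (level u).+1.
Proof.
rewrite mxE; case: (boolP (~~ odd u && _)) => [/andP[eu /eqP vu] _|_].
  by rewrite /level vu; lia.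
case: (boolP ((r < u)%N && _)) => [/andP[ru /eqP vu] _|_]; last by rewrite addr0 eqxx.
by have := ltn_ord u; rewrite /level vu; lia.
Qed.

Lemma meander_principal : principal_element meander_functional principal.
Proof.
move=> x; rewrite meander_functional_lie lfunE /= /meander_fun; congr (\tr (_ *m _)).
rewrite lie_mx_traceless; apply/matrixP => u v.
have -> : lie_mx meander_mx level_mx = - lie_mx level_mx meander_mx.
  by rewrite /lie_mx opprB.
rewrite mxE lie_level_mx; have [->|/meander_level ->] := eqVneq (meander_mx u v) 0.
  by rewrite mulr0 oppr0.
by rewrite -mulNr opprB -natr1 addrC addKr mul1r.
Qed.

(* The diagonal entry (0, 0) is left out: it is determined by the trace. *)
Definition root_index :=
  {p : 'I_n * 'I_n | (p.1./2 <= p.2./2)%N && (p != (ord0, ord0))}.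

Definition root_mx (p : 'I_n * 'I_n) : 'M[K]_n :=
  delta_mx p.1 p.2 - (p.1 == p.2)%:R *: delta_mx ord0 ord0.

Lemma root_parabolic (p : root_index) : root_mx (val p) \in g.
Proof.
case: p => -[i j] /= /andP[ij _]; apply/mem_parabolic; split=> [|a b ba].
  rewrite /root_mx linearB linearZ /= -[delta_mx ord0 ord0]mul1mx mxtrace_mul_delta.
  rewrite -[delta_mx i j]mul1mx mxtrace_mul_delta !mxE eqxx mulr1.
  by rewrite eq_sym subrr.
rewrite !mxE /= (_ : (a == i) && _ = false); last first.
  by apply: contraTF ba => /andP[/eqP -> /eqP ->]; rewrite -leqNgt.
rewrite (_ : (a == _) && _ = false) ?mulr0 ?subrr //.
by apply: contraTF ba => /andP[/eqP -> /eqP ->]; rewrite ltnn.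
Qed.

Definition root_vector (p : root_index) : subvs_of g := Subvs (root_parabolic p).

Definition root_weight (p : root_index) : K :=
  (level (val p).1)%:R - (level (val p).2)%:R.

(** The trace correction of [root_mx] sits at (0, 0), which is not an index, so entries at the
    indices are the coordinates dual to the root vectors. *)
Lemma root_vector_entry (p q : root_index) :
  vsval (root_vector p) (val q).1 (val q).2 = (p == q)%:R.
Proof.
have -> : (p == q) = (val p == val q) by [].
case: p q => [[i j] p] [[a b] q] /=; rewrite !mxE /= xpair_eqE.
have /andP[_] := q; rewrite xpair_eqE => /negbTE ab0.
rewrite [X in _ - _ * (nat_of_bool X)%:R]ab0 mulr0 subr0.
by rewrite [i == a]eq_sym [j == b]eq_sym.
Qed.

Lemma root_entries_eq0 (x : subvs_of g) :
  (forall p : root_index, vsval x (val p).1 (val p).2 = 0) -> x = 0.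
Proof.
move=> x0; have /mem_parabolic[trx xlow] := subvsP x.
have xE i j : (i, j) != (ord0, ord0) :> 'I_n * 'I_n -> vsval x i j = 0.
  move=> ij; have [ji|ij'] := ltnP j./2 i./2; first exact: xlow.
  have pP : ((i, j).1./2 <= (i, j).2./2)%N && ((i, j) != (ord0, ord0)) by rewrite ij'.
  exact: (x0 (exist _ (i, j) pP)).
apply: val_inj; apply/matrixP => i j /=; rewrite [RHS]mxE.
have [[-> ->]|/xE //] := eqVneq (i, j) (ord0, ord0).
rewrite -trx /mxtrace (bigD1 ord0) //= big1 ?addr0 // => k k0.
by rewrite xE // xpair_eqE negb_and k0.
Qed.

Lemma vsval_sum (c : root_index -> K) (q : root_index) :
  vsval (\sum_p c p *: root_vector p) (val q).1 (val q).2 = c q.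
Proof.
rewrite linear_sum summxE (bigD1 q) //= mxE root_vector_entry eqxx mulr1.
rewrite big1 ?addr0 // => p /negPf pq.
by rewrite mxE root_vector_entry pq mulr0.
Qed.

Lemma root_vector_free (c : root_index -> K) :
  \sum_p c p *: root_vector p = 0 -> forall p, c p = 0.
Proof. by move=> c0 p; rewrite -vsval_sum c0 mxE. Qed.

Lemma root_vector_span (x : subvs_of g) :
  exists c : root_index -> K, x = \sum_p c p *: root_vector p.
Proof.
exists (fun p => vsval x (val p).1 (val p).2); apply/eqP; rewrite -subr_eq0.
apply/eqP/root_entries_eq0 => p; rewrite /= 2!mxE.
have := vsval_sum (fun p => vsval x (val p).1 (val p).2) p => /= ->.
by rewrite subrr.
Qed.

Lemma lie_root_vector (p : root_index) :
  lie principal (root_vector p) = root_weight p *: root_vector p.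
Proof.
apply: val_inj; rewrite /= vsval_lie; last exact: parabolic_lie.
rewrite /= lie_traceless_mx; apply/matrixP => a b; rewrite lie_level_mx !mxE /root_weight.
case: p => -[i j] /= _; rewrite !mulrBr; congr (_ - _).
  by case: andP => [[/eqP -> /eqP ->] //|_]; rewrite !mulr0.
have [->|_] := eqVneq i j; last by rewrite !mul0r !mulr0.
by case: andP => [[/eqP -> /eqP ->]|_]; rewrite ?mulr0 // !subrr !mul0r.
Qed.

End Parabolic.

(** * Multiplicities *)

Section Weights.

Variables (K : numFieldType) (r : nat).
Hypothesis r_gt0 : (0 < r)%N.
Local Notation N := r.*2.
Local Notation n := N.+1.

(* Weights are written [k - 1] so that levels are compared in [nat] without
   truncated subtraction. *)
Lemma root_weightE (p : root_index r) k :
  (root_weight K p == k%:R - 1)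
    = ((level r (val p).1).+1 == level r (val p).2 + k)%N.
Proof.
by rewrite /root_weight subr_eq addrAC eq_sym subr_eq natr1 -natrD eqr_nat addnC eq_sym.
Qed.

(** For i./2 <= j./2 the block indicator contributes 0 or 1 to the weight and parity contributes -1,
    0 or 1. *)
Lemma root_weight_range (p : root_index r) :
  exists2 k, (k <= 3)%N & root_weight K p = k%:R - 1.
Proof.
have /andP[ij _] := valP p.
exists ((level r (val p).1).+1 - level r (val p).2)%N; first by rewrite /level; lia.
by apply/eqP; rewrite root_weightE /level; lia.
Qed.

Definition weight_set z := [set p : root_index r | root_weight K p == z].

Lemma card_weight_set z :
  #|weight_set z| = count_mem z [seq root_weight K p | p <- enum {: root_index r}].
Proof.
rewrite count_map -sum1_count big_enum_cond /= -sum1_card.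
by apply: eq_bigl => p; rewrite inE.
Qed.

Lemma root_index_exists (i j : nat) :
  (i <= N)%N -> (j <= N)%N -> (i./2 <= j./2)%N -> (0 < i + j)%N ->
  exists p : root_index r, (val p).1 = i :> nat /\ (val p).2 = j :> nat.
Proof.
move=> iN jN ij ij0.
pose q : 'I_n * 'I_n := (inord i, inord j).
have qP : (q.1./2 <= q.2./2)%N && (q != (ord0, ord0)).
  by rewrite /= !inordK // ij xpair_eqE -!val_eqE /= !inordK //; lia.
by exists (exist _ q qP); rewrite /= !inordK.
Qed.

Lemma weight2_gt0 : (0 < #|weight_set (3%:R - 1)%R|)%N.
Proof.
(* Row 1 has the top level 2 and column N has level 0. *)
have [||||p [p1 p2]] := @root_index_exists 1 N; try lia.
apply/card_gt0P; exists p; rewrite inE root_weightE p1 p2 /level; lia.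
Qed.

Lemma weight2_lt_weight1 : (#|weight_set (3%:R - 1)%R| < #|weight_set (2%:R - 1)%R|)%N.
Proof.
(* [insubd] falls back on p itself off the index set. Weight 2 excludes this: it forces i odd, so i
   - 1 stays in its block, and j of level 0, so j is not 0. *)
pose f (p : root_index r) : root_index r :=
  insubd p (inord (val p).1.-1, (val p).2).
have fE p : p \in weight_set (3%:R - 1)%R ->
    odd (val p).1 /\ val (f p) = (inord (val p).1.-1, (val p).2).
  rewrite inE root_weightE; case: p => -[i j] p /=; have /andP[/= ij _] := p.
  have iN := ltn_ord i => wp; have oi : odd i by move: wp; rewrite /level; lia.
  split=> //; apply: insubdK; rewrite -topredE /= xpair_eqE -!val_eqE /= inordK; last by lia.
  by move: wp; rewrite /level; lia.
(* The index (1, 0) has weight 1 and an odd row, whereas [f] sends weight 2 to even rows. *)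
have [||||q [q1 q2]] := @root_index_exists 1 0; try lia.
have finj : {in weight_set (3%:R - 1)%R &, injective f}.
  move=> p p' /fE[op fp] /fE[op' fp'] /(congr1 val); rewrite fp fp'.
  case=> /(congr1 val) /= e1 e2; apply: val_inj.
  rewrite !inordK ?(leq_ltn_trans (leq_pred _)) // in e1.
  rewrite [LHS]surjective_pairing [RHS]surjective_pairing; congr (_, _) => //.
  apply: val_inj; move: e1 op op' => /=.
  by move: (nat_of_ord _) (nat_of_ord _) => i i'; lia.
rewrite -(card_in_imset finj); apply/proper_card/properP; split.
  apply/subsetP => _ /imsetP[p pw ->]; have [op fp] := fE p pw.
  rewrite inE root_weightE fp /= inordK ?(leq_ltn_trans (leq_pred _)) //.
  move: pw op; rewrite inE root_weightE /level /=.
  by move: (nat_of_ord _) (nat_of_ord _) => i j; lia.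
exists q; first by rewrite inE root_weightE q1 q2 /level; lia.
apply/imsetP => -[p pw qE]; have [op fp] := fE p pw.
move: q1 op; rewrite qE fp /= inordK ?(leq_ltn_trans (leq_pred _)) //.
by move: (nat_of_ord _) => i; lia.
Qed.

(** The injection [s] carries weight y to weight 1 - y; using it for y = z and for y = 1 - z gives
    both inequalities. *)
Lemma card_weight_dual (s : {perm root_index r}) z :
  (forall p, root_weight K p + root_weight K (s p) = 1) ->
  #|weight_set z| = #|weight_set (1 - z)|.
Proof.
move=> sw; have le y : (#|weight_set y| <= #|weight_set (1 - y)%R|)%N.
  rewrite -(card_imset _ (@perm_inj _ s)); apply/subset_leq_card/subsetP.
  move=> _ /imsetP[p pw ->]; rewrite !inE in pw *.
  by rewrite -(eqP pw) -(sw p) addrC addKr.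
by apply/eqP; rewrite eqn_leq le /= -{2}(subKr 1 z) le.
Qed.

End Weights.

(** * Assembling the spectrum *)

Lemma perm_eq_spectrum (K : numFieldType) (s : seq K) a b :
  (forall z, z \in s -> exists2 k, (k <= 3)%N & z = k%:R - 1) ->
  count_mem (0%:R - 1) s = b -> count_mem (1%:R - 1) s = a ->
  count_mem (2%:R - 1) s = a -> count_mem (3%:R - 1) s = b ->
  perm_eq s (nseq b (-1) ++ nseq a 0 ++ nseq a 1 ++ nseq b 2%:R).
Proof.
move=> sP c0 c1 c2 c3.
have -> : nseq b (-1) ++ nseq a 0 ++ nseq a 1 ++ nseq b 2%:R
   = nseq b (0%:R - 1) ++ nseq a (1%:R - 1) ++ nseq a (2%:R - 1) ++ nseq b (3%:R - 1) :> seq K.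
  rewrite sub0r subrr; congr (_ ++ (_ ++ (nseq _ _ ++ nseq _ _))).
    by rewrite -[2%:R]natr1 addrK.
  by rewrite -[3%:R]natr1 addrK.
set t := _ ++ _.
have tP z : z \in t ->
    exists2 k, (k <= 3)%N & z = k%:R - 1 :> K.
  rewrite /t !mem_cat !mem_nseq => /or4P[]/andP[_ /eqP ->].
  - by exists 0%N.
  - by exists 1%N.
  - by exists 2%N.
  - by exists 3%N.
apply/allP => z; rewrite mem_cat => zP.
have [k k3 ->] : exists2 k, (k <= 3)%N & z = k%:R - 1 by case/orP: zP => [/sP|/tP].
(* In characteristic 0 the four values k - 1 are distinct, so counting reduces to comparing naturals
   k. *)
rewrite /t /= !count_cat !count_nseq /= !(inj_eq (addIr _)) !eqr_nat.
case: k k3 => [|[|[|[|//]]]] _; rewrite ?c0 ?c1 ?c2 ?c3 /=; lia.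
Qed.

Lemma parabolic_spectrum (C : numClosedFieldType) (r : nat) :
  (0 < r)%N ->
  exists a b : nat,
    (0 < b < a)%N /\
    has_spectrum (parabolic C r) (nseq b (-1) ++ nseq a 0 ++ nseq a 1 ++ nseq b 2%:R).
Proof.
move=> r_gt0; have C0 : [pchar C] =i pred0 by exact: pchar_num.
have g_lie := @parabolic_lie C r.
have frob0 := meander_frobenius C0 r_gt0.
have prin0 := meander_principal C0 r_gt0.
have eig (p : root_index r) := lie_root_vector C0 p.
have [s sw] := principal_eigenbasis_duality g_lie frob0 prin0
  (@root_vector_free C r) (@root_vector_span C r) eig.
exists #|weight_set (K := C) r (2%:R - 1)%R|, #|weight_set (K := C) r (3%:R - 1)%R|.
rewrite weight2_gt0 // weight2_lt_weight1 //; split=> //.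
split=> [|F frobF]; first by exists (meander_functional C r).
have [h hF] := principal_element_exists g_lie frobF; exists h; split=> //.
have charE := char_poly_end_principal C0 g_lie frobF frob0 hF.1 prin0.
apply: perm_trans (perm_eigenvalues charE) _.
have eig' p : ad (principal r C0) (root_vector C p) = root_weight C p *: root_vector C p.
  by rewrite lfunE; exact: eig.
apply: perm_trans (eigenvalues_eigenbasis (@root_vector_free C r) (@root_vector_span C r) eig') _.
apply: perm_eq_spectrum; rewrite -?card_weight_set.
- by move=> _ /mapP[p _ ->]; exact: root_weight_range.
(* Weights -1 and 0 are counted through their duals 2 and 1, whose multiplicities are the chosen b
   and a. *)
- by rewrite (card_weight_dual _ sw); congr #|weight_set r _|; ring.
- by rewrite (card_weight_dual _ sw); congr #|weight_set r _|; ring.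
- by [].
- by [].
Qed.

Theorem mainTheorem6 (R : realType) (r : nat) (hr : (1 <= r)%N) :
  exists a b : nat,
    (0 < b < a)%N /\
    has_spectrum
      (@seaweed R[i] (2 * r + 1) (nseq r 2%N ++ [:: 1%N]) [:: (2 * r + 1)%N])
      (nseq b (-1) ++ nseq a 0 ++ nseq a 1 ++ nseq b 2%:R).
Proof.
rewrite addn1 mul2n; exact: parabolic_spectrum.
Qed.
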